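(* Let $d\ge 2$ and consider first-passage percolation on $\mathbb{Z}^d$ with i.i.d. non-negative edge passage times $(\tau(e))_{e\in\mathcal{E}}$. Let $S_-$ and $S_+$ be the infimum and supremum of the support of the common distribution of the $\tau(e)$. Assume $0<S_-$ and $S_+\le 2S_-$. Then for every integer $n\ge 1$, $$a(n)\ \ge\ a(n-1)+S_-\left[1-\frac{(S_+-S_-)^2}{S_-^2}\right].$$ In particular the sequence $(a(n))_{n\ge 0}$ is non-decreasing.
   Context: $\mathbb{Z}^d$ is viewed as a graph with vertex set $\mathbb{Z}^d$ and an (unoriented) edge between two vertices at Euclidean distance $1$; $\mathcal{E}$ is its edge set. A path from $a$ to $b$ is a finite sequence of vertices $r=(a=x_0,\dots,x_k=b)$ with $x_i,x_{i+1}$ adjacent for all $i$; its passage time is $\tau(r)=\sum_{i=0}^{k-1}\tau(x_i,x_{i+1})$. The passage time from $a$ to $b$ is $T(a,b)=\inf\{\tau(r): r \text{ a path from } a \text{ to } b\}$. Let $e_1,\dots,e_d$ be the canonical basis of $\mathbb{R}^d$, and $a(n)=E(T(0,ne_1))$. *)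

(* Defs.v *)
From HB Require Import structures.
From mathcomp Require Import all_boot all_order all_algebra.
From mathcomp Require Import all_classical all_reals all_analysis.
Set Implicit Arguments. Unset Strict Implicit. Unset Printing Implicit Defensive.
Import Order.TTheory GRing.Theory Num.Theory.
Import numFieldNormedType.Exports.
Local Open Scope classical_set_scope.
Local Open Scope ring_scope.

Definition vtx (dim : nat) := 'rV[int]_dim.

Definition evec (dim : nat) (i : 'I_dim) : vtx dim := \row_(j < dim) ((j == i)%:R : int).

Definition e1 (dim : nat) : vtx dim := \row_(j < dim) (((val j == 0)%N)%:R : int).

Definition adj (dim : nat) : rel (vtx dim) :=
  fun x y => \sum_(j < dim) ((x - y) 0 j) ^+ 2 == 1.

(* Edges of Z^dim are indexed bijectively by pairs (x, i) : the edge {x, x + e_i}. *)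
Definition edge (dim : nat) := (vtx dim * 'I_dim)%type.

Definition edge_time (R : realType) (dim : nat) (t : edge dim -> R) (x y : vtx dim) : R :=
  match [pick i | y == x + evec i] with
  | Some i => t (x, i)
  | None => match [pick i | x == y + evec i] with
            | Some i => t (y, i)
            | None => 0
            end
  end.

Definition path_time (R : realType) (dim : nat) (t : edge dim -> R) (a : vtx dim)
    (s : seq (vtx dim)) : R :=
  \sum_(p <- zip (a :: s) s) edge_time t p.1 p.2.

Definition passage_time (R : realType) (dim : nat) (t : edge dim -> R) (a b : vtx dim) : R :=
  inf [set r : R | exists s : seq (vtx dim),
        [/\ path (@adj dim) a s, last a s = b & r = path_time t a s]].

Definition mutually_independent (d : measure_display) (T : measurableType d)
    (R : realType) (P : probability T R) (I : eqType) (X : I -> {RV P >-> R}) : Prop :=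
  forall (s : seq I) (B : I -> set R), uniq s -> (forall i, measurable (B i)) ->
    (P (\big[setI/setT]_(i <- s) (X i @^-1` B i)) = \prod_(i <- s) P (X i @^-1` B i))%E.

Definition identically_distributed (d : measure_display) (T : measurableType d)
    (R : realType) (P : probability T R) (I : Type) (X : I -> {RV P >-> R}) : Prop :=
  forall i j (B : set R), measurable B -> P (X i @^-1` B) = P (X j @^-1` B).

Definition law_support (d : measure_display) (T : measurableType d)
    (R : realType) (P : probability T R) (X : {RV P >-> R}) : set R :=
  [set x | forall e : R, 0 < e -> (0 < P (X @^-1` ball x e))%E].

Definition mean_pt (d : measure_display) (T : measurableType d)
    (R : realType) (P : probability T R) (dim : nat) (tau : edge dim -> {RV P >-> R})
    (n : nat) : \bar R :=
  (\int[P]_w (passage_time (fun e => tau e w) 0 (n%:Z *: e1 dim))%:E)%E.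

(* Main.v *)
Require Import Defs.
From HB Require Import structures.
From mathcomp Require Import all_boot all_order all_algebra.
From mathcomp Require Import all_classical all_reals all_analysis.
From mathcomp Require Import measurable_realfun zify ring lra.
Set Implicit Arguments. Unset Strict Implicit. Unset Printing Implicit Defensive.
Import Order.TTheory GRing.Theory Num.Theory.
Import numFieldNormedType.Exports.
Local Open Scope classical_set_scope.
Local Open Scope ring_scope.

(** Remove from [Z^d] the layer of first coordinate [k], [1 <= k <= n]: the edges
    from level [k - 1] to level [k] are contracted and the edges inside level [k]
    are dropped. The remaining passage times are again i.i.d., and a path [r] from
    [0] to [n e_1] becomes a path from [0] to [(n - 1) e_1]: it saves the crossings
    into level [k], at least one, each worth at least [Sm], and loses at most
    [Sp - Sm] for each of its edges inside level [k]. Every edge of [r] is charged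
    to at most one [k]; since the passage time is at most [n Sp], a nearly optimal
    [r] has about [n Sp / Sm] edges at most, so at most about [n (Sp - Sm) / Sm]
    of them lie inside the removed layers. Averaging over [k] gives the inequality
    almost surely, and then in expectation. *)

(** * Paths in the lattice *)

Section lattice.
Context (dim : nat).
Implicit Types x y a b : vtx dim.

Lemma evec_inj : injective (@evec dim).
Proof.
move=> i j /rowP/(_ i); rewrite !mxE eqxx.
by case: eqP.
Qed.

Lemma evecD_neq0 (i j : 'I_dim) : evec i + evec j != 0.
Proof.
apply/eqP => /rowP/(_ i); rewrite !mxE eqxx.
by case: (i == j).
Qed.

(** Integer squares summing to 1: exactly one coordinate of [x - y] is nonzero, and it is 1 or
    -1. *)
Lemma adjP x y : adj x y ->
  exists i, y = x + evec i \/ x = y + evec i.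
Proof.
rewrite /adj => /eqP h.
have hle i : ((x - y) 0 i) ^+ 2 <= 1.
  rewrite -h (bigD1 i)//= lerDl sumr_ge0// => j _; exact: sqr_ge0.
have [i hi] : exists i, (x - y) 0 i != 0.
  apply/existsP; apply: contraPT h => /existsPn h0; rewrite big1// => i _.
  by move: (h0 i); rewrite negbK => /eqP ->; rewrite expr0n.
have hj j : j != i -> (x - y) 0 j = 0.
  move=> ji; apply/eqP; rewrite -sqrf_eq0; apply/eqP.
  have h2 : 0 <= \sum_(k < dim | (k != i) && (k != j)) ((x - y) 0 k) ^+ 2.
    by apply: sumr_ge0 => k _; exact: sqr_ge0.
  move: h; rewrite (bigD1 i)//= (bigD1 j)//=.
  move: h2 hi; move: (\sum_(k < dim | _) _) ((x-y) 0 i) ((x-y) 0 j) => A u v.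
  nia.
exists i.
have [h1|h1] : (x - y) 0 i = 1 \/ (x - y) 0 i = -1.
  by move: (hle i) hi; rewrite expr2; move: ((x-y) 0 i) => u; nia.
- right; apply/rowP => j; have [->|ji] := eqVneq j i.
    by move: h1; rewrite !mxE eqxx; move: (x 0 i) (y 0 i); lia.
  by move: (hj _ ji); rewrite !mxE (negbTE ji); move: (x 0 j) (y 0 j); lia.
- left; apply/rowP => j; have [->|ji] := eqVneq j i.
    by move: h1; rewrite !mxE eqxx; move: (x 0 i) (y 0 i); lia.
  by move: (hj _ ji); rewrite !mxE (negbTE ji); move: (x 0 j) (y 0 j); lia.
Qed.

Lemma adj_sym x y : adj x y = adj y x.
Proof.
rewrite /adj; congr (_ == _); apply: eq_bigr => i _.
by rewrite -(opprB y x) mxE sqrrN.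
Qed.

Lemma adjDevec x i : adj x (x + evec i).
Proof.
rewrite /adj opprD addNKr (bigD1 i)//= !mxE eqxx sqrrN expr1n big1 ?addr0// => j ji.
by rewrite !mxE (negbTE ji) oppr0 expr0n.
Qed.

Context (R : realType).
Implicit Types t : edge dim -> R.

Lemma edge_time_fwd t x i : edge_time t x (x + evec i) = t (x, i).
Proof.
rewrite /edge_time; case: pickP => [j|/(_ i)]; last by rewrite eqxx.
by move=> /eqP/addrI/evec_inj ->.
Qed.

Lemma edge_time_bwd t x i : edge_time t (x + evec i) x = t (x, i).
Proof.
rewrite /edge_time; case: pickP => [j|_].
  rewrite -addrA -{1}[x]addr0 => /eqP/addrI/esym/eqP.
  by rewrite (negbTE (evecD_neq0 _ _)).
case: pickP => [j|/(_ i)]; last by rewrite eqxx.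
by move=> /eqP/addrI/evec_inj ->.
Qed.

(** Which edge is read depends on the endpoints alone, not on [t]; measurability of path times in
    [t] rests on this. *)
Lemma edge_timeE x y :
  exists oe : option (edge dim), forall t, edge_time t x y = oapp t 0 oe.
Proof.
rewrite /edge_time; case: pickP => [i _|_]; first by exists (Some (x, i)).
by case: pickP => [i _|_]; [exists (Some (y, i))|exists None].
Qed.

Lemma edge_time_ge0 t x y : (forall e, 0 <= t e) -> 0 <= edge_time t x y.
Proof. by move=> t0; have [[e|] ->] := edge_timeE x y => /=. Qed.

(** [path_time] with arbitrary weights, so that edges of a given kind can be counted along a
    path. *)
Definition path_sum (w : vtx dim -> vtx dim -> R) a (s : seq (vtx dim)) : R :=
  \sum_(p <- zip (a :: s) s) w p.1 p.2.

Lemma path_sum_nil w a : path_sum w a [::] = 0.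
Proof. by rewrite /path_sum big_nil. Qed.

Lemma path_sum_cons w a x s : path_sum w a (x :: s) = w a x + path_sum w x s.
Proof. by rewrite /path_sum big_cons. Qed.

Lemma path_timeE t a s : path_time t a s = path_sum (edge_time t) a s.
Proof. by []. Qed.

Lemma path_sum_le w1 w2 a s : path (@adj dim) a s ->
  (forall x y, adj x y -> w1 x y <= w2 x y) -> path_sum w1 a s <= path_sum w2 a s.
Proof.
move=> + h; elim: s a => [|x s IH] a /=; first by rewrite !path_sum_nil.
by move=> /andP[ax xs]; rewrite !path_sum_cons lerD ?h ?IH.
Qed.

Lemma path_time_ge0 t a s : (forall e, 0 <= t e) -> 0 <= path_time t a s.
Proof. by move=> t0; apply: sumr_ge0 => p _; exact: edge_time_ge0. Qed.

Lemma passage_time_le t a b s : (forall e, 0 <= t e) ->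
  path (@adj dim) a s -> last a s = b -> passage_time t a b <= path_time t a s.
Proof.
move=> t0 ps ls; apply: ge_inf; last by exists s.
by exists 0 => _ [s' [_ _ ->]]; exact: path_time_ge0.
Qed.

Lemma passage_time_ge0 t a b : (forall e, 0 <= t e) -> 0 <= passage_time t a b.
Proof.
move=> t0; rewrite /passage_time; set S := mkset _.
(* Without any path the infimum is over the empty set, where it is 0 by convention. *)
have [->|/set0P S0] := eqVneq S set0; first by rewrite inf0.
by apply: lb_le_inf => // _ [s [_ _ ->]]; exact: path_time_ge0.
Qed.

End lattice.

(** * Removing a layer *)

Section layer.
Context (m : nat).
Local Notation dim := m.+1.
Implicit Types x y a b : vtx dim.
Local Notation adj := (@adj dim).

Definition lvl x : int := x 0 ord0.

Lemma lvlD x y : lvl (x + y) = lvl x + lvl y.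
Proof. by rewrite /lvl mxE. Qed.

Lemma lvlN x : lvl (- x) = - lvl x.
Proof. by rewrite /lvl mxE. Qed.

Lemma e1E : e1 dim = evec ord0.
Proof. by apply/rowP => j; rewrite !mxE. Qed.

Lemma lvl_evec i : lvl (evec i : vtx dim) = (i == ord0)%:R.
Proof. by rewrite /lvl mxE eq_sym. Qed.

Lemma lvl_e1 : lvl (e1 dim) = 1.
Proof. by rewrite e1E lvl_evec. Qed.

Lemma lvl_ne1 (n : nat) : lvl (n%:Z *: e1 dim) = n%:Z.
Proof. by rewrite /lvl !mxE /= mulr1. Qed.

Context (k : int).

Definition contract x : vtx dim := if k <= lvl x then x - e1 dim else x.

(* The edge of the original lattice whose time the edge [e] of the contracted
   lattice inherits; the edges inside level [k] have no preimage, level [k - 1]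
   keeping its own. *)
Definition expand_edge (e : edge dim) : edge dim :=
  if k <= lvl (e.1 + evec e.2) then (e.1 + e1 dim, e.2) else e.

(** Only a left inverse: edges inside level [k] or from level [k - 1] to it are outside the image.
    It witnesses the injectivity that keeps the relabelled times i.i.d. *)
Definition expand_edge_inv (e : edge dim) : edge dim :=
  if k <= lvl (e.1 - e1 dim + evec e.2) then (e.1 - e1 dim, e.2) else e.

Lemma expand_edgeK : cancel expand_edge expand_edge_inv.
Proof.
move=> [y i]; rewrite /expand_edge /=; case: ifPn => h; rewrite /expand_edge_inv /=.
  by rewrite addrK h.
rewrite ifF//; apply/negbTE; move: h.
by rewrite !lvlD lvlN lvl_e1; move: (lvl _) (lvl _) => u v; lia.
Qed.

Context (R : realType) (t : edge dim -> R) (Sm Sp : R).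
Hypothesis (tge : forall e, Sm <= t e) (tle : forall e, t e <= Sp).

(** Edges inside level [k] and edges crossing into it are both charged [Sp - Sm]; crossings are also
    credited [Sp], a net gain of [Sm]. Since only the upper level matters, an edge is charged for at
    most one layer. *)
Definition top_at x y : R := (Num.max (lvl x) (lvl y) == k)%:R.

Definition crosses x y : R :=
  ((Num.max (lvl x) (lvl y) == k) && (lvl x != lvl y))%:R.

Lemma top_at_sym x y : top_at x y = top_at y x.
Proof. by rewrite /top_at maxC. Qed.

Lemma crosses_sym x y : crosses x y = crosses y x.
Proof. by rewrite /crosses maxC [lvl x == _]eq_sym. Qed.

(** Three kinds of edges: those from level [k - 1] to [k] collapse, those inside level [k] get the
    time of their translate in level [k - 1], all others keep their own. *)
Lemma contract_fwd x i : let y := x + evec i in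
  [/\ contract y = contract x, top_at x y = 1 & crosses x y = 1]
  \/ [/\ contract y = contract x + evec i, crosses x y = 0 &
      expand_edge (contract x, i) = (x, i) \/ top_at x y = 1].
Proof.
rewrite /contract /top_at /crosses /expand_edge /= lvlD lvl_evec.
have [->|i0] := eqVneq i ord0 => /=.
  have -> : Num.max (lvl x) (lvl x + 1) = lvl x + 1 by move: (lvl x) => u; lia.
  have [kx|kx|kx] := ltgtP k (lvl x + 1).
  - right; rewrite (_ : k <= lvl x); last by move: (lvl x) kx => u; lia.
    rewrite addrAC; split=> //; left.
    by rewrite !lvlD lvlN !lvl_e1 ifT ?subrK//; move: (lvl x) kx => u; lia.
  - right; rewrite (_ : (k <= lvl x) = false); last by move: (lvl x) kx => u; lia.
    split=> //; left.
    by rewrite lvlD lvl_evec (_ : (k <= _) = false)//; move: (lvl x) kx => u; lia.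
  - left; rewrite kx (_ : (_ <= lvl x) = false); last by move: (lvl x) => u; lia.
    rewrite e1E addrK; split=> //.
    by rewrite (_ : (lvl x != _) = true)//; move: (lvl x) => u; lia.
right; rewrite !addr0 !maxxx eqxx andbF lvlD lvl_evec (negbTE i0) addr0.
have [kx|kx|kx] := ltgtP k (lvl x).
- rewrite addrAC; split=> //; left.
  by rewrite !lvlD lvlN lvl_e1 ifT ?subrK//; move: (lvl x) kx => u; lia.
- by split=> //; left; rewrite (_ : (k <= _) = false)// leNgt kx.
- by rewrite addrAC; split=> //; right.
Qed.

(** For a collapsed edge the right-hand side is its time minus [Sm]; inside level [k], old and new
    times differ by at most [Sp - Sm]. *)
Lemma contract_step x y : adj x y ->
  (contract x = contract y /\
     0 <= edge_time t x y + (Sp - Sm) * top_at x y - Sp * crosses x y)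
  \/ (adj (contract x) (contract y) /\
     edge_time (t \o expand_edge) (contract x) (contract y) <=
     edge_time t x y + (Sp - Sm) * top_at x y - Sp * crosses x y).
Proof.
have SmSp : Sm <= Sp := le_trans (tge (x, ord0)) (tle (x, ord0)).
have main z i e (T C : R) :
     [/\ contract (z + evec i) = contract z, T = 1 & C = 1]
  \/ [/\ contract (z + evec i) = contract z + evec i, C = 0 &
      expand_edge (contract z, i) = (z, i) \/ T = 1] -> T = top_at z (z + evec i) ->
  e = t (z, i) ->
  (contract (z + evec i) = contract z /\ 0 <= e + (Sp - Sm) * T - Sp * C) \/
  [/\ contract (z + evec i) = contract z + evec i
    & t (expand_edge (contract z, i)) <= e + (Sp - Sm) * T - Sp * C].
  move=> [[-> -> ->] _ ->|[-> -> [eE|->]] TE ->].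
  - by left; split=> //; move: (tge (z, i)); lra.
  - right; split=> //; rewrite eE mulr0 subr0 lerDl mulr_ge0//.
      by rewrite subr_ge0 SmSp.
    by rewrite TE ler0n.
  - by right; split=> //; move: (tge (z, i)) (tle (expand_edge (contract z, i))); lra.
move=> /adjP[i [->|->]].
- have := main _ _ _ _ _ (contract_fwd x i) erefl (edge_time_fwd t x i).
  move=> [[-> h]|[-> h]]; [by left|right].
  by rewrite adjDevec edge_time_fwd.
- rewrite top_at_sym crosses_sym.
  have := main _ _ _ _ _ (contract_fwd y i) erefl (edge_time_bwd t y i).
  move=> [[-> h]|[-> h]]; [by left|right].
  by rewrite adj_sym adjDevec edge_time_bwd.
Qed.

(** Collapsed steps are dropped from the path, and the bounds for single steps add up. *)
Lemma contract_path a s : path adj a s ->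
  exists s', [/\ path adj (contract a) s', last (contract a) s' = contract (last a s) &
    path_time (t \o expand_edge) (contract a) s' <=
    path_time t a s + (Sp - Sm) * path_sum top_at a s - Sp * path_sum crosses a s].
Proof.
elim: s a => [|x s IH] a /=.
  by move=> _; exists [::]; rewrite /= !path_timeE !path_sum_nil; split=> //; lra.
move=> /andP[ax /IH[s' [ps' ls']]].
rewrite !path_timeE !path_sum_cons => hs'.
have [[-> h]|[ax' h]] := contract_step ax.
  by exists s'; split=> //; move: hs' h; rewrite path_timeE; lra.
exists (contract x :: s') => /=; rewrite ax' ps'; split=> //.
by move: hs' h; rewrite !path_timeE path_sum_cons; lra.
Qed.

Lemma crosses_ge0 x y : 0 <= crosses x y.
Proof. exact: ler0n. Qed.

(** A step changes the level by at most 1, so the first step to reach level [k] starts at level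
    [k - 1]. *)
Lemma path_crosses a s : path adj a s -> lvl a < k -> k <= lvl (last a s) ->
  1 <= path_sum crosses a s.
Proof.
elim: s a => [|x s IH] a /=; first by move=> _ h1 h2; lia.
move=> /andP[ax xs] ak ks; rewrite path_sum_cons.
have [xk|kx] := ltP (lvl x) k.
  by rewrite ler_wpDl ?crosses_ge0 ?IH.
rewrite ler_wpDr//; first by apply: sumr_ge0 => p _; exact: crosses_ge0.
suff -> : crosses a x = 1 by [].
rewrite /crosses (_ : (_ && _) = true)//.
have /adjP[i] := ax; have lei : 0 <= lvl (evec i : vtx dim) <= 1 by rewrite lvl_evec; case: eqP.
move=> [/(congr1 lvl)|/(congr1 lvl)]; rewrite lvlD;
  move: (lvl a) (lvl x) (lvl (evec i)) lei ak kx; lia.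
Qed.

End layer.

(** * Averaging over the removed layers *)

Section average.
Context (m : nat) (R : realType) (t : edge m.+1 -> R) (Sm Sp : R).
Local Notation dim := m.+1.
Local Notation adj := (@adj dim).
Hypothesis (tge : forall e, Sm <= t e) (tle : forall e, t e <= Sp).
Hypothesis (Sm0 : 0 < Sm).

Let t0 e : 0 <= t e. Proof. exact: le_trans (ltW Sm0) (tge e). Qed.

(** Besides bounding the passage time, this path shows that the infimum is over a nonempty set. *)
Lemma straight_path (a : vtx dim) (n : nat) :
  exists s, [/\ path adj a s, last a s = a + n%:Z *: e1 dim &
    path_time t a s <= n%:R * Sp].
Proof.
elim: n a => [|n IH] a.
  by exists [::]; rewrite /= path_timeE path_sum_nil scale0r addr0 mul0r.
have [s [ps ls hs]] := IH (a + e1 dim).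
exists ((a + e1 dim) :: s); split.
- by rewrite /= ps andbT e1E adjDevec.
- by rewrite /= ls -addrA intS scalerDl scale1r.
- rewrite path_timeE path_sum_cons {1}e1E edge_time_fwd -natr1 mulrDl mul1r addrC.
  by rewrite lerD.
Qed.

Lemma passage_time_straight (n : nat) :
  passage_time t 0 (n%:Z *: e1 dim) <= n%:R * Sp.
Proof.
have [s [ps + /(le_trans _)]] := straight_path 0 n; rewrite add0r => ls; apply.
exact: passage_time_le.
Qed.

Lemma path_sum_sum (I : Type) (r : seq I) (w : I -> vtx dim -> vtx dim -> R) a s :
  \sum_(i <- r) path_sum (w i) a s = path_sum (fun x y => \sum_(i <- r) w i x y) a s.
Proof. exact: exchange_big. Qed.

Lemma path_sumZ (c : R) (w : vtx dim -> vtx dim -> R) a s :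
  c * path_sum w a s = path_sum (fun x y => c * w x y) a s.
Proof. exact: mulr_sumr. Qed.

Lemma sum_top_at (n : nat) (x y : vtx dim) :
  \sum_(i < n) top_at i.+1%:Z R x y <= 1.
Proof.
rewrite /top_at -natr_sum (ler_nat R _ 1).
have [[j ->]|h] := pselect (exists j : 'I_n, Num.max (lvl x) (lvl y) = j.+1%:Z).
  rewrite (bigD1 j)//= eqxx big1 ?addn0// => i ij.
  by apply/eqP; rewrite eqb0 eqz_nat eqSS; apply: contra ij => /eqP/val_inj ->.
by rewrite big1// => i _; apply/eqP; rewrite eqb0; apply/eqP => e; apply: h; exists i.
Qed.

(* Each edge of a path has its upper endpoint in at most one layer, so the
   path has on average few edges in the removed layer. *)
Lemma sum_removed_path (n : nat) s : path adj 0 s -> last 0 s = n.+1%:Z *: e1 dim ->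
  \sum_(i < n.+1) passage_time (t \o expand_edge i.+1%:Z) 0 (n%:Z *: e1 dim) <=
  n.+1%:R * path_time t 0 s + (Sp - Sm) * (path_time t 0 s / Sm) - n.+1%:R * Sp.
Proof.
move=> ps ls.
have SmSp : Sm <= Sp := le_trans (tge (0, ord0)) (tle (0, ord0)).
have step (i : 'I_n.+1) : passage_time (t \o expand_edge i.+1%:Z) 0 (n%:Z *: e1 dim) <=
    path_time t 0 s + (Sp - Sm) * path_sum (top_at i.+1%:Z R) 0 s - Sp.
  have [s' []] := contract_path i.+1%:Z tge tle ps.
  have -> : contract i.+1%:Z (0 : vtx dim) = 0.
    by rewrite /contract /lvl mxE.
  have -> : contract i.+1%:Z (last 0 s) = n%:Z *: e1 dim.
    rewrite ls /contract lvl_ne1 lez_nat ltn_ord.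
    by rewrite intS scalerDl scale1r addrAC subrr add0r.
  move=> ps' ls' hs'.
  have /le_trans -> // : passage_time (t \o expand_edge i.+1%:Z) 0 (n%:Z *: e1 dim)
     <= path_time (t \o expand_edge i.+1%:Z) 0 s'.
    by apply: passage_time_le => // e /=; exact: t0.
  apply: (le_trans hs'); rewrite lerD2l lerN2 ler_peMr//.
    exact: le_trans (ltW Sm0) SmSp.
  by apply: path_crosses => //; rewrite ?ls ?lvl_ne1 ?lez_nat// /lvl mxE.
apply: le_trans (ler_sum _ (fun i _ => step i)) _.
rewrite !big_split/= !sumr_const card_ord -mulr_sumr.
rewrite -[path_time _ _ _ *+ _]mulr_natl -[(- Sp) *+ _]mulr_natl mulrN lerD2r lerD2l ler_wpM2l ?subr_ge0//.
(* The number of charged edges is at most the path time over [Sm], as each edge costs at least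
   [Sm]. *)
rewrite path_sum_sum ler_pdivlMr// mulrC path_sumZ.
apply: path_sum_le => // x y xy.
apply: (@le_trans _ _ Sm); first by rewrite ler_piMr ?sum_top_at// ltW.
by have /adjP[i [->|->]] := xy; rewrite ?edge_time_fwd ?edge_time_bwd.
Qed.

(** The bound for one path is affine and increasing in its time, so it passes to the infimum. In the
    term counting charged edges, the passage time is then replaced by its upper bound
    [n.+1%:R * Sp]. *)
Lemma sum_removed_passage_time (n : nat) :
  \sum_(i < n.+1) passage_time (t \o expand_edge i.+1%:Z) 0 (n%:Z *: e1 dim) +
    n.+1%:R * (Sm * (1 - (Sp - Sm) ^+ 2 / Sm ^+ 2)) <=
  n.+1%:R * passage_time t 0 (n.+1%:Z *: e1 dim).
Proof.
have SmSp : Sm <= Sp := le_trans (tge (0, ord0)) (tle (0, ord0)).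
set A := \sum_(i < _) _; set T := passage_time t _ _; set N : R := n.+1%:R.
(* The slope of the affine bound. *)
set c := N + (Sp - Sm) / Sm.
have c0 : 0 < c by rewrite ltr_pwDl ?ltr0n// divr_ge0 ?subr_ge0// ltW.
have AT : (A + N * Sp) / c <= T.
  apply: lb_le_inf.
    by have [s [ps + _]] := straight_path 0 n.+1; rewrite add0r => ls; exists (path_time t 0 s), s.
  move=> _ [s [ps ls ->]]; rewrite ler_pdivrMr// -lerBrDr.
  apply: le_trans (sum_removed_path ps ls) _.
  by rewrite lerD2r /c mulrDr mulrC lerD2l mulrCA.
have TN : T <= N * Sp := passage_time_straight n.+1.
move: AT; rewrite ler_pdivrMr// /c => AT.
have h : T * ((Sp - Sm) / Sm) <= N * Sp * ((Sp - Sm) / Sm).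
  by rewrite ler_wpM2r// divr_ge0 ?subr_ge0// ltW.
(* With [D = Sp - Sm], both sides equal [N * (Sm - D) * (Sm + D) / Sm]. *)
have -> : N * (Sm * (1 - (Sp - Sm) ^+ 2 / Sm ^+ 2)) =
   N * Sp - N * Sp * ((Sp - Sm) / Sm).
  by field; rewrite gt_eqF.
by move: AT h; rewrite mulrDr (mulrC T N); lra.
Qed.

End average.

(** * Joint laws of independent families *)

(** A generating pi-system of the product sigma-algebra. Taking [B] total, with [setT] off [s], lets
    cylinders be intersected coordinatewise. *)
Definition cylinder (R : realType) (I : choiceType) : set (set (I -> R)) :=
  [set A | exists (s : seq I) (B : I -> set R),
    [/\ forall i, measurable (B i), forall i, i \notin s -> B i = setT &
        A = [set t | forall i, B i (t i)]]].

Section joint_law.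
Context (R : realType) (I : choiceType).
Local Notation cyl := (@cylinder R I).
Local Notation RI := (g_sigma_algebraType (@cylinder R I)).

Lemma cylinder_setT : cyl setT.
Proof.
exists [::], (fun=> setT); split=> //.
by apply/seteqP; split.
Qed.

Lemma cylinder_setI : setI_closed cyl.
Proof.
move=> _ _ [s [B [mB sB ->]]] [s' [B' [mB' sB' ->]]].
exists (s ++ s'), (fun i => B i `&` B' i); split.
- by move=> i; exact: measurableI.
- by move=> i; rewrite mem_cat negb_or => /andP[/sB -> /sB' ->]; rewrite setTI.
- by apply/seteqP; split=> t /=; [move=> [h h'] i|move=> h; split=> i; case: (h i)].
Qed.

Lemma measurable_coord (i : I) : measurable_fun (setT : set RI) (fun t : RI => t i : R).
Proof.
move=> _ B mB; rewrite setTI; apply: sub_sigma_algebra.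
exists [:: i], (fun j => if j == i then B else setT); split.
- by move=> j; case: ifP.
- by move=> j; rewrite inE => /negbTE ->.
- apply/seteqP; split=> t /=; first by move=> h j; case: eqP => // ->.
  by move=> /(_ i); rewrite eqxx.
Qed.

Context (d : measure_display) (T : measurableType d) (P : probability T R).

(** [undup] is there because independence is stated for duplicate-free lists. *)
Lemma preimage_cylinder (X : I -> T -> R) (s : seq I) (B : I -> set R) :
  (forall i, i \notin s -> B i = setT) ->
  (fun w => (fun i => X i w) : RI) @^-1` [set t | forall i, B i (t i)] =
  \big[setI/setT]_(i <- undup s) (X i @^-1` B i).
Proof.
move=> sB; rewrite -bigcap_seq; apply/seteqP; split=> w /=.
  by move=> h i _; exact: h.
move=> h i; have [si|/sB -> //] := boolP (i \in s).
by apply: h; rewrite /= mem_undup.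
Qed.

Lemma measurable_fun_family (X : I -> T -> R) :
  (forall i, measurable_fun setT (X i)) ->
  measurable_fun setT (fun w => (fun i => X i w) : RI).
Proof.
move=> mX; apply: (@measurability _ _ T RI setT _ cyl) => //.
move=> _ [_ [s [B [mB sB ->]]] <-].
rewrite setTI (preimage_cylinder _ sB).
apply: bigsetI_measurable => i _.
by rewrite -[X in measurable X]setTI; exact: mX.
Qed.

(** The laws of the two families on the product space agree on cylinders, hence everywhere.
    Injectivity of [f] keeps the indices distinct, so that independence applies. *)
Lemma integral_reindex (X : I -> {RV P >-> R}) (f g : I -> I) (F : RI -> R) :
  mutually_independent X -> identically_distributed X -> cancel f g ->
  measurable_fun setT F -> (forall t, 0 <= F t) ->
  (\int[P]_w (F (fun i => X (f i) w))%:E = \int[P]_w (F (fun i => X i w))%:E)%E.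
Proof.
move=> indep idd fK mF F0.
pose Y w : RI := fun i => X i w.
pose Z w : RI := fun i => X (f i) w.
have mY : measurable_fun setT Y by exact: measurable_fun_family.
have mZ : measurable_fun setT Z by exact: measurable_fun_family.
have mEF : measurable_fun (setT : set RI) (EFin \o F : RI -> \bar R) by exact/measurable_EFinP.
have E0 : {in setT, forall t : RI, (0 <= (EFin \o F) t)%E}.
  by move=> t _ /=; rewrite lee_fin.
rewrite -[LHS](ge0_integral_pushforward mZ P measurableT mEF E0).
rewrite -[RHS](ge0_integral_pushforward mY P measurableT mEF E0).
apply: eq_measure_integral => A mA _.
apply: (@measure_unique _ R RI cyl (fun=> setT)) => //.
- exact: cylinder_setI.
- by move=> _; exact: cylinder_setT.
- by rewrite bigcup_const.
- move=> _ [s [B [mB sB ->]]].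
  have EY : Y @^-1` [set t | forall i, B i (t i)] =
    \big[setI/setT]_(i <- undup s) (X i @^-1` B i) := preimage_cylinder _ sB.
  have EZ : Z @^-1` [set t | forall i, B i (t i)] =
    \big[setI/setT]_(i <- undup s) (X (f i) @^-1` B i) := preimage_cylinder _ sB.
  rewrite /= /pushforward /= EY EZ indep ?undup_uniq//.
  (* At the index [f i], the family [B \o g] takes the value [B i]. *)
  have := indep (map f (undup s)) (B \o g).
  rewrite !big_map map_inj_uniq ?undup_uniq; last exact: can_inj fK.
  under eq_bigr do rewrite /= fK.
  move=> -> //; last by move=> i; exact: mB.
  by apply: eq_bigr => i _; rewrite /= fK; exact: idd.
- by move=> _; rewrite /= /pushforward preimage_setT probability_setT ltry.
Qed.

End joint_law.

(** * Measurability of passage times *)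

Section passage_time_measurable.
Context (R : realType) (dim : nat).
Local Notation RE := (g_sigma_algebraType (@cylinder R (edge dim))).

Lemma measurable_path_time (a : vtx dim) s :
  measurable_fun (setT : set RE) (fun t : RE => path_time (fun e => `|t e|) a s).
Proof.
apply: measurable_sum => p.
have [[e|] pE] := edge_timeE R p.1 p.2.
  rewrite (_ : (fun t => _) = (fun t : RE => `|t e|)); last first.
    by apply/funext => t; rewrite pE.
  apply: measurableT_comp; first exact: normr_measurable.
  exact: measurable_coord.
rewrite (_ : (fun t => _) = cst 0); last by apply/funext => t; rewrite pE.
exact: measurable_cst.
Qed.

(* The absolute values keep the set of path times bounded below, where [inf]
   is meaningful; they disappear on nonnegative edge times. *)
Lemma measurable_passage_time (a b : vtx dim) :
  measurable_fun (setT : set RE)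
    (fun t : RE => passage_time (fun e => `|t e|) a b).
Proof.
pose Q (s : seq (vtx dim)) := path (@adj dim) a s /\ last a s = b.
have [[s0 [ps0 ls0]]|noQ] := pselect (exists s, Q s); last first.
  rewrite (_ : (fun t : RE => _) = cst 0); first exact: measurable_cst.
  apply/funext => t; rewrite /passage_time (_ : mkset _ = set0) ?inf0//.
  by apply/seteqP; split=> // r [s [ps ls _]]; apply: noQ; exists s.
apply: (measurability _ (RGenInftyO.measurableE R)) => // _ [_ [r ->] <-].
rewrite setTI.
(* The infimum is below [r] exactly when some path has time below [r], and there are countably many
   vertex lists. *)
rewrite (_ : _ @^-1` _ = \bigcup_s (if `[<Q s>] then
    [set t : RE | path_time (fun e => `|t e|) a s < r] else set0)); last first.
  apply/seteqP; split=> [t /=|t [s _]].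
    rewrite in_itv /= => /inf_lt[|_ [s [ps ls ->]] sr].
      by exists (path_time (fun e => `|t e|) a s0), s0.
    by exists s => //; rewrite asboolT.
  case: asboolP => // -[ps ls] /= h; rewrite in_itv /=.
  by apply: le_lt_trans h; apply: passage_time_le => // e; exact: normr_ge0.
apply: countable_bigcupT_measurable => [|s].
  exact: countableP.
case: asboolP => // _.
have := measurable_path_time a s measurableT (measurable_itv `]-oo, r[).
rewrite setTI; congr measurable.
Qed.

End passage_time_measurable.

(** * The support of a law *)

Lemma negligible_bigcup_countable (d : measure_display) (T : measurableType d)
  (R : realType) (mu : {measure set T -> \bar R}) (I : countType) (F : I -> set T) :
  (forall i, mu.-negligible (F i)) -> mu.-negligible (\bigcup_i F i).
Proof.
move=> F0; apply: (@negligibleS _ _ _ _ (\bigcup_n oapp F set0 (unpickle n))).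
  by move=> x [i _ Fx]; exists (pickle i) => //; rewrite pickleK.
by apply: negligible_bigcup => n; case: unpickle => [i|] //=; exact: negligible_set0.
Qed.

Section support.
Context (d : measure_display) (T : measurableType d) (R : realType)
  (P : probability T R) (X : {RV P >-> R}).

(** A point outside the support has a null ball around it, hence lies in a null ball with rational
    centre and radius; there are countably many of these. *)
Lemma negligible_preimage_supportC (A : set R) :
  A `&` law_support X `<=` set0 -> P.-negligible (X @^-1` A).
Proof.
move=> AX.
have mb x r : measurable (X @^-1` ball (x : R) r).
  by rewrite -[X in measurable X]setTI; apply: measurable_funPT => //; exact: measurable_ball.
pose F (pq : rat * rat) := let B := X @^-1` ball (ratr pq.1 : R) (ratr pq.2) in
  if P B == 0%E then B else set0.
apply: (@negligibleS _ _ _ _ (\bigcup_pq F pq)); last first.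
  apply: negligible_bigcup_countable => pq; rewrite /F.
  case: eqP => [h|_]; last exact: negligible_set0.
  exact/negligibleP.
move=> w /= Aw.
have [e e0 Pe] : exists2 e : R, 0 < e & P (X @^-1` ball (X w) e) = 0%E.
  apply: contrapT => h; apply: (AX (X w)); split=> // e e0.
  rewrite lt0e measure_ge0 andbT; apply/eqP => Pe; apply: h; by exists e.
(* The centre [p] is within [e / 4] of [X w] and the radius [q] is between [e / 4] and [e / 2]: the
   rational ball contains [X w] and stays within [e] of it. *)
have [q] := @rat_in_itvoo R (e / 4) (e / 2) ltac:(lra).
rewrite in_itv /= => /andP[q1 q2].
have [p] := @rat_in_itvoo R (X w - e / 4) (X w + e / 4) ltac:(lra).
rewrite in_itv /= => /andP[p1 p2].
have sub : ball (ratr p : R) (ratr q) `<=` ball (X w) e.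
  move=> z; rewrite /ball /= !ltr_norml => /andP[z1 z2]; apply/andP; split; lra.
exists (p, q) => //; rewrite /F ifT.
  by rewrite /= /ball /= ltr_norml; apply/andP; split; lra.
apply/eqP/le_anti/andP; split; last exact: measure_ge0.
rewrite -Pe; apply: le_measure; rewrite ?inE//.
by apply: preimage_subset.
Qed.

Lemma law_support_bounds (Sm Sp x : R) :
  ereal_inf (EFin @` law_support X) = Sm%:E ->
  ereal_sup (EFin @` law_support X) = Sp%:E -> law_support X x -> Sm <= x <= Sp.
Proof.
move=> infE supE hx; rewrite -!lee_fin -infE -supE; apply/andP; split.
  by apply: ge_ereal_inf; exists x%:E => //; exists x.
by apply: le_ereal_sup_tmp; exists x%:E => //; exists x.
Qed.

End support.

Lemma ae_in_support_hull (d : measure_display) (T : measurableType d) (R : realType)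
  (P : probability T R) (I : countType) (X : I -> {RV P >-> R}) (i0 : I) (Sm Sp : R) :
  identically_distributed X ->
  ereal_inf (EFin @` law_support (X i0)) = Sm%:E ->
  ereal_sup (EFin @` law_support (X i0)) = Sp%:E ->
  {ae P, forall w, forall i, Sm <= X i w <= Sp}.
Proof.
move=> idd infE supE.
have mC : measurable (~` `[Sm, Sp] : set R) by exact: measurableC.
have Pi i : P (X i @^-1` (~` `[Sm, Sp])) = 0%E.
  rewrite (idd i i0)//; apply: measure_negligible.
    by rewrite -[X in measurable X]setTI; apply: measurable_funPT.
  apply: negligible_preimage_supportC => x [/= xC /(law_support_bounds infE supE)].
  by move: xC; rewrite /= in_itv.
apply: (@negligibleS _ _ _ _ (\bigcup_i X i @^-1` (~` `[Sm, Sp]))).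
  by move=> w /existsNP[i hi]; exists i => //= iw; apply: hi; move: iw; rewrite in_itv.
apply: negligible_bigcup_countable => i; apply/negligibleP.
  by rewrite -[X in measurable X]setTI; apply: measurable_funPT.
exact: Pi.
Qed.

(** * The inequality in expectation *)

Theorem theorem1 (d : measure_display) (T : measurableType d) (R : realType)
  (P : probability T R) (dim : nat) (tau : edge dim -> {RV P >-> R})
  (e0 : edge dim) (Sm Sp : R) :
  (2 <= dim)%N ->
  mutually_independent tau ->
  identically_distributed tau ->
  (forall e w, 0 <= tau e w) ->
  ereal_inf (EFin @` law_support (tau e0)) = Sm%:E ->
  ereal_sup (EFin @` law_support (tau e0)) = Sp%:E ->
  0 < Sm -> Sp <= 2 * Sm ->
  (forall n : nat, (1 <= n)%N ->
     (mean_pt tau n >= mean_pt tau n.-1 + (Sm * (1 - (Sp - Sm) ^+ 2 / Sm ^+ 2))%:E)%E)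
  /\ (forall n : nat, (mean_pt tau n <= mean_pt tau n.+1)%E).
Proof.
case: dim tau e0 => // m tau e0 _ indep idd tau0 infE supE Sm0 SpSm.
set c := Sm * _.
have hull := ae_in_support_hull idd infE supE.
have SmSp : Sm <= Sp.
  (* An empty support would have infimum [+oo], not the real [Sm]. *)
  have [S0|/set0P[x /(law_support_bounds infE supE)/andP[/le_trans]]] :=
    eqVneq (law_support (tau e0)) set0; last exact.
  by move: infE; rewrite S0 image_set0 ereal_inf0.
(* Here [Sp <= 2 * Sm] enters, as [Sp - Sm <= Sm]. *)
have c0 : 0 <= c.
  rewrite mulr_ge0 ?(ltW Sm0)// subr_ge0 ler_pdivrMr ?exprn_gt0// mul1r.
  by rewrite ler_sqr ?nnegrE; lra.
pose F n (t : g_sigma_algebraType (@cylinder R (edge m.+1))) :=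
  passage_time (fun e => `|t e|) 0 (n%:Z *: e1 m.+1).
have mF n : measurable_fun setT (F n) by exact: measurable_passage_time.
have F0 n t : 0 <= F n t by apply: passage_time_ge0 => e; exact: normr_ge0.
have FE n (f : edge m.+1 -> edge m.+1) w :
    F n (fun e => tau (f e) w) = passage_time (fun e => tau (f e) w) 0 (n%:Z *: e1 m.+1).
  by rewrite /F; congr passage_time; apply/funext => e; rewrite ger0_norm.
have mtau n (f : edge m.+1 -> edge m.+1) :
    measurable_fun setT (fun w => (F n (fun e => tau (f e) w))%:E).
  apply/measurable_EFinP; apply: (measurableT_comp (mF n)).
  by apply: (measurable_fun_family (X := fun e w => tau (f e) w)) => e.
have meanE n : mean_pt tau n = (\int[P]_w (F n (fun e => tau e w))%:E)%E.
  by apply: eq_integral => w _; rewrite (FE n id).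
(* Multiplied by [n.+1], the left mean becomes a sum over the removed layers, whose passage times
   all have mean [mean_pt tau n]. *)
have main n : (mean_pt tau n + c%:E <= mean_pt tau n.+1)%E.
  have N0 : (0 < n.+1%:R%:E :> \bar R)%E by rewrite lte_fin.
  rewrite -(lee_pmul2l _ N0)// ge0_muleDr ?lee_fin//; last first.
    by rewrite meanE; apply: integral_ge0 => w _; rewrite lee_fin.
  have -> : (n.+1%:R%:E * mean_pt tau n.+1 =
      \int[P]_w (n.+1%:R%:E * (F n.+1 (fun e => tau e w))%:E))%E.
    rewrite meanE (ge0_integralZl_EFin P measurableT _ (mtau n.+1 id))// => w _.
    by rewrite lee_fin.
  pose S w := (\sum_(i < n.+1) (F n (fun e => tau (expand_edge i.+1%:Z e) w))%:E)%E.
  have S0 w : setT w -> (0 <= S w)%E by move=> _; apply: sume_ge0 => i _; rewrite lee_fin.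
  have mS : measurable_fun setT S by apply: emeasurable_sum => i; exact: mtau.
  have c'0 (w : T) : setT w -> (0 <= (n.+1%:R * c)%:E)%E by rewrite lee_fin mulr_ge0.
  have -> : (n.+1%:R%:E * mean_pt tau n + n.+1%:R%:E * c%:E =
    \int[P]_w (S w + (n.+1%:R * c)%:E))%E.
    rewrite (ge0_integralD P measurableT S0 mS c'0 (measurable_cst _)).
    rewrite (ge0_integral_sum P measurableT (fun i : 'I_n.+1 => mtau n (expand_edge i.+1%:Z))); last first.
      by move=> i w _; rewrite lee_fin.
    have -> : (\int[P]_(w in setT) (n.+1%:R * c)%:E = (n.+1%:R * c)%:E)%E.
      by rewrite -[RHS]mule1 -(probability_setT P); exact: integral_cst.
    rewrite EFinM; congr (_ + _)%E.
    under eq_bigr => i _.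
      rewrite (@integral_reindex _ _ _ _ _ tau _ _ (F n) indep idd (@expand_edgeK _ _)) //.
      rewrite -meanE.
      over.
    by rewrite sumr_const card_ord mule_natl.
  apply: ae_ge0_le_integral => //.
  - by move=> w _; apply: adde_ge0; [exact: S0|exact: (c'0 w)].
  - by apply: emeasurable_funD => //; exact: measurable_cst.
  - by move=> w _; rewrite -EFinM lee_fin mulr_ge0.
  - by apply: measurable_funeM; exact: (mtau n.+1 id).
  (* Almost surely all edge times lie in [[Sm, Sp]], and there the averaged inequality holds
     pointwise. *)
  apply: filterS hull => w hw _.
  rewrite /S sumEFin -EFinD -EFinM lee_fin (FE n.+1 id).
  under eq_bigr do rewrite FE.
  apply: sum_removed_passage_time => // e; by case/andP: (hw e).
split=> [[//|n] _|n]; first exact: (main n).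
by apply: le_trans (main n); rewrite leeDl// lee_fin.
Qed.
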